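(* Let $n$ be a positive integer and let $p(x,y)$ be a bivariate polynomial of the form $$p(x,y)=\sum_{i=0}^n y^i\sum_{j=0}^{\lfloor (n-i)/2\rfloor}\mu_{n,i,j}\,x^j(1+x)^{n-i-2j}$$ with real coefficients $\mu_{n,i,j}\geqslant 0$ for all $0\leqslant i\leqslant n$ and $0\leqslant j\leqslant\lfloor (n-i)/2\rfloor$. Suppose that $\deg p(x,1)=n-1$ and that $p(x,1)$ is bi-$\gamma$-positive (with respect to degree $n-1$), i.e. there are nonnegative reals $\xi_k,\eta_k$ with $$p(x,1)=\sum_{k=0}^{\lfloor (n-1)/2\rfloor}\xi_k x^k(1+x)^{n-1-2k}+x\sum_{k=0}^{\lfloor (n-2)/2\rfloor}\eta_k x^k(1+x)^{n-2-2k}.$$ Let $y\in[0,1]$ be a fixed real number. Then $p(x,y)$, viewed as a polynomial in $x$, is alternatingly increasing: writing $p(x,y)=\sum_{\ell} p_\ell x^\ell$, one has $$p_0\leqslant p_{n-1}\leqslant p_1\leqslant p_{n-2}\leqslant p_2\leqslant\cdots\leqslant p_{\lfloor n/2\rfloor}.$$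
   Context: A polynomial $f(x)=\sum_{i=0}^d f_ix^i$ of degree $d$ is alternatingly increasing if $f_0\leqslant f_d\leqslant f_1\leqslant f_{d-1}\leqslant\cdots\leqslant f_{\lfloor (d+1)/2\rfloor}$. A polynomial $f$ of degree $d$ is bi-$\gamma$-positive if in its (unique) symmetric decomposition $f(x)=a(x)+xb(x)$, where $a(x)=\frac{f(x)-x^{d+1}f(1/x)}{1-x}$ and $b(x)=\frac{x^df(1/x)-f(x)}{1-x}$, both $a$ and $b$ are $\gamma$-positive, equivalently $f(x)=\sum_k \xi_k x^k(1+x)^{d-2k}+x\sum_k\eta_k x^k(1+x)^{d-1-2k}$ with all $\xi_k,\eta_k\geqslant 0$. *)

(* Defs.v *)
From mathcomp Require Import all_boot all_order all_algebra.
From mathcomp Require Import zify ring.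
Set Implicit Arguments.
Unset Strict Implicit.
Unset Printing Implicit Defensive.
Import Order.TTheory GRing.Theory Num.Theory.
Local Open Scope ring_scope.

(* In this file [d] is the (possibly nominal) degree of the polynomial
   concerned; it is passed explicitly because the notions depend on it. *)

(* x^d f(1/x), for f of degree at most d. *)
Definition recip_poly (R : nzRingType) (d : nat) (f : {poly R}) : {poly R} :=
  \poly_(i < d.+1) f`_(d - i).

Definition gamma_basis (R : nzRingType) (d k : nat) : {poly R} :=
  'X^k * (1 + 'X) ^+ (d - k.*2).

Definition gamma_positive (R : numDomainType) (d : nat) (f : {poly R}) : Prop :=
  exists g : nat -> R,
    (forall k, (k <= d./2)%N -> 0 <= g k) /\
    f = \sum_(k < d./2.+1) g k *: gamma_basis R d k.

(* The symmetric decomposition f = a + x b. The divisions by 1 - x are exact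
   when f has degree at most d, see [sym_decompE]. *)
Definition sym_part_a (R : idomainType) (d : nat) (f : {poly R}) : {poly R} :=
  (f - 'X * recip_poly d f) %/ (1 - 'X).

Definition sym_part_b (R : idomainType) (d : nat) (f : {poly R}) : {poly R} :=
  (recip_poly d f - f) %/ (1 - 'X).

(* For d = 0 the truncated d.-1 is harmless, since then b = 0. *)
Definition bi_gamma_positive (R : realFieldType) (d : nat) (f : {poly R}) :
    Prop :=
  gamma_positive d (sym_part_a d f) /\ gamma_positive d.-1 (sym_part_b d f).

(* 0, d, 1, d - 1, 2, ...; the term of rank d is (d + 1)/2, see [alt_indexdd]. *)
Definition alt_index (d k : nat) : nat := if odd k then (d - k./2)%N else k./2.

(* The size condition says that the chain f_0 <= f_d <= f_1 <= ... involves all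
   the coefficients of f; the coefficient f_d may vanish. *)
Definition alternatingly_increasing (R : numDomainType) (d : nat)
    (f : {poly R}) : Prop :=
  (size f <= d.+1)%N /\
  forall k, (k < d)%N -> f`_(alt_index d k) <= f`_(alt_index d k.+1).

Lemma alt_indexdd d : alt_index d d = d.+1./2.
Proof. by rewrite /alt_index; case: ifP => ?; lia. Qed.

Section SymmetricDecomposition.
Variable R : realFieldType.
Implicit Types (f a b : {poly R}) (d k : nat).

Let sub1X_neq0 : (1 - 'X : {poly R}) != 0.
Proof. by rewrite -opprB oppr_eq0 -[1]/(1%:P) polyXsubC_eq0. Qed.

Let sub1X_dvd f : f.[1] = 0 -> (1 - 'X) %| f.
Proof.
move=> f1; rewrite -opprB dvdpNl -[1]/(1%:P) dvdp_XsubCl.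
exact/rootP.
Qed.

Lemma horner_recip1 d f : (size f <= d.+1)%N -> (recip_poly d f).[1] = f.[1].
Proof.
move=> sf; rewrite horner_poly (horner_coef_wide _ sf) (reindex_inj rev_ord_inj).
apply: eq_bigr => i _ /=; rewrite !expr1n !mulr1 subSS; congr (f`_ _).
by have := ltn_ord i; lia.
Qed.

Lemma sym_decompE d f : (size f <= d.+1)%N ->
  f = sym_part_a d f + 'X * sym_part_b d f.
Proof.
move=> sf; apply: (mulIf sub1X_neq0); rewrite mulrDl -mulrA.
rewrite /sym_part_a /sym_part_b !divpK ?sub1X_dvd ?hornerE ?horner_recip1 //.
- by ring.
- by rewrite subrr.
- by rewrite subrr.
Qed.

Lemma coef_gamma_basis d k i :
  (gamma_basis R d k)`_i = if (i < k)%N then 0 else 'C(d - k.*2, i - k)%:R.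
Proof.
rewrite coefXnM; case: ifP => // _.
have -> : (1 + 'X) ^+ (d - k.*2) =
    \sum_(j < (d - k.*2).+1) ('C(d - k.*2, j)%:R : R) *: 'X^j.
  rewrite exprDn; apply: eq_bigr => j _.
  by rewrite expr1n mul1r scaler_nat.
rewrite -(poly_def _ (fun j => 'C(d - k.*2, j)%:R)) coef_poly.
by case: ltnP => // h; rewrite bin_small.
Qed.

Lemma recip_gamma_basis d k : (k <= d./2)%N ->
  recip_poly d (gamma_basis R d k) = gamma_basis R d k.
Proof.
move=> kd; apply/polyP => i; rewrite coef_poly !coef_gamma_basis.
have [id | id] := ltnP i d.+1; last first.
  by case: ltnP => // h; rewrite bin_small //; lia.
have [h1|h1] := ltnP i k; have [h2|h2] := ltnP (d - i) k => //.
- by rewrite bin_small //; lia.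
- by rewrite bin_small //; lia.
- rewrite -(@bin_sub (d - k.*2) (i - k)); last lia.
  by congr ('C(_, _)%:R); lia.
Qed.

Lemma recip_gamma_sum d (g : nat -> R) (m : nat) : (m <= d./2.+1)%N ->
  recip_poly d (\sum_(k < m) g k *: gamma_basis R d k) =
  \sum_(k < m) g k *: gamma_basis R d k.
Proof.
move=> md; apply/polyP => i; rewrite coef_poly !coef_sum.
case: ltnP => id.
  apply: eq_bigr => k _; rewrite !coefZ -[in RHS]recip_gamma_basis.
    by rewrite coef_poly id.
  by have := ltn_ord k; lia.
apply/esym/big1 => k _; rewrite coefZ -recip_gamma_basis.
  by rewrite coef_poly ltnNge id mulr0.
by have := ltn_ord k; lia.
Qed.

Lemma bi_gamma_positiveP d f : (size f <= d.+1)%N ->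
  bi_gamma_positive d f <->
  exists xi eta : nat -> R,
    [/\ forall k, (k < d./2.+1)%N -> 0 <= xi k,
        forall k, (k < d.+1./2)%N -> 0 <= eta k &
        f = \sum_(k < d./2.+1) xi k *: ('X^k * (1 + 'X) ^+ (d - k.*2))
          + 'X * \sum_(k < d.+1./2)
                   eta k *: ('X^k * (1 + 'X) ^+ (d.-1 - k.*2))].
Proof.
move=> sf; split.
  move=> [[xi [xi0 Ea]] [eta [eta0 Eb]]]; exists xi, eta; split.
  - by move=> k; rewrite ltnS; apply: xi0.
  - by move=> k kd; apply: eta0; lia.
  rewrite {1}(sym_decompE sf) Ea; congr (_ + 'X * _).
  case: d sf {Ea} Eb xi0 eta0 => [|d] sf Eb xi0 eta0; last by rewrite Eb.
  rewrite big_ord0 /sym_part_b (_ : recip_poly 0 f = f) ?subrr ?div0p //.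
  apply/polyP=> -[|i]; rewrite coef_poly //=.
  by rewrite nth_default // (leq_trans sf).
move=> [xi [eta [xi0 eta0 Ef]]].
set a := \sum_(k < d./2.+1) _ in Ef; set b := \sum_(k < d.+1./2) _ in Ef.
have ra : recip_poly d a = a by apply: recip_gamma_sum.
have rb : recip_poly d ('X * b) = b.
  case: d sf @a @b xi0 eta0 Ef ra => [|d] sf a b xi0 eta0 Ef ra.
    rewrite /b big_ord0 mulr0; apply/polyP=> i.
    by rewrite coef_poly !coef0 if_same.
  have {2}<- : recip_poly d b = b by apply: recip_gamma_sum.
  apply/polyP => i; rewrite !coef_poly coefXM.
  have [h|h] := ltnP i d.+1; last by rewrite subn_eq0 h if_same.
  by rewrite ltnS ltnW // subn_eq0 leqNgt h /=; congr (b`_ _); lia.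
have rf : recip_poly d f = a + b.
  rewrite -[in RHS]ra -[in RHS]rb Ef; apply/polyP => i.
  by rewrite coefD !coef_poly coefD; case: ifP => // _; rewrite addr0.
split.
  exists xi; split; first by move=> k kd; apply: xi0.
  rewrite /sym_part_a rf Ef (_ : _ - _ = a * (1 - 'X)) ?mulpK //; ring.
have -> : sym_part_b d f = b.
  rewrite /sym_part_b rf Ef (_ : _ - _ = b * (1 - 'X)) ?mulpK //; ring.
case: d sf @a @b xi0 eta0 Ef {ra rb rf} => [|d] sf a b xi0 eta0 Ef.
  exists (fun=> 0); split=> //; rewrite /b big_ord0 big1 // => k _.
  by rewrite scale0r.
by exists eta; split => // k kd; apply: eta0.
Qed.

End SymmetricDecomposition.

(* Main.v *)
Require Import Defs.
From mathcomp Require Import all_boot all_order all_algebra.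
From mathcomp Require Import zify.
Set Implicit Arguments.
Unset Strict Implicit.
Unset Printing Implicit Defensive.
Import Order.TTheory GRing.Theory Num.Theory.
Local Open Scope ring_scope.

(** Write p(x,y) = sum_i p_i(x) y^i, where p_i is gamma-positive of nominal
    degree n - i, hence symmetric and unimodal about (n - i)/2.
    Since (n - i)/2 <= n/2, the coefficient of p_i at n - m, for m <= n/2, is at
    most that at m; this gives half of the chain, for every y >= 0.
    For the other half, with k <= n-1-k, let D_i be the coefficient of p_i at k
    minus that at n-1-k.  Then D_i >= 0 for all i >= 1, so
    sum_i D_i y^i <= sum_i D_i when 0 <= y <= 1, and the latter is nonpositive
    by bi-gamma-positivity of p(x,1). *)

(** Passing from [l] to [l.+1] multiplies the binomial by (N - l)/(l + 1), which is at least 1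
    exactly when 2(l + 1) <= N + 1. *)
Lemma leq_bin_lower_half N k l : (k <= l)%N -> (l.*2 <= N.+1)%N ->
  ('C(N, k) <= 'C(N, l))%N.
Proof.
elim: l => [|l IHl]; first by rewrite leqn0 => /eqP->.
rewrite leq_eqVlt => /predU1P[-> // | kl] lN.
apply: leq_trans (IHl kl _) _; first lia.
rewrite -(leq_pmul2l (ltn0Sn l)) mul_bin_left leq_mul2r; lia.
Qed.

(** Given k <= l, the bound k + l <= N says that [l] is no farther than [k] from the centre N/2. If
    [l] lies past the centre, reflect it to [N - l]. *)
Lemma leq_bin_unimodal N k l : (k <= l)%N -> (k + l <= N)%N ->
  ('C(N, k) <= 'C(N, l))%N.
Proof.
move=> kl klN; have [lN | Nl] := leqP l.*2 N.
  by apply: leq_bin_lower_half; lia.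
rewrite -(@bin_sub N l); last lia.
by apply: leq_bin_lower_half; lia.
Qed.

Section GammaPositive.
Variable R : realFieldType.
Implicit Types (f : {poly R}) (d k l : nat).

Lemma gamma_basis_coef_le d j k l : (j <= d./2)%N ->
  (k <= l)%N -> (k + l <= d)%N ->
  (gamma_basis R d j)`_k <= (gamma_basis R d j)`_l.
Proof.
move=> jd kl kld; rewrite !coef_gamma_basis.
case: (ltnP k j) => kj; case: (ltnP l j) => lj //; first lia.
by rewrite ler_nat; apply: leq_bin_unimodal; lia.
Qed.

Lemma gamma_positive_coef_ge0 d f k : gamma_positive d f -> 0 <= f`_k.
Proof.
move=> [g [g0 ->]]; rewrite coef_sum sumr_ge0 // => j _.
rewrite coefZ mulr_ge0 ?g0 ?coef_gamma_basis -1?ltnS //.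
by case: ifP.
Qed.

Lemma gamma_positive_coef_le d f k l : gamma_positive d f ->
  (k <= l)%N -> (k + l <= d)%N -> f`_k <= f`_l.
Proof.
move=> [g [g0 ->]] kl kld; rewrite !coef_sum ler_sum // => j _.
have jd : (j <= d./2)%N by rewrite -ltnS.
by rewrite !coefZ ler_wpM2l ?g0 // gamma_basis_coef_le.
Qed.

Lemma gamma_positive_recip d f : gamma_positive d f -> recip_poly d f = f.
Proof. by move=> [g [_ ->]]; apply: recip_gamma_sum. Qed.

Lemma gamma_positive_coef_gt d f k : gamma_positive d f -> (d < k)%N ->
  f`_k = 0.
Proof.
by move=> /gamma_positive_recip<- dk; rewrite coef_poly ltnS leqNgt dk.
Qed.

Lemma gamma_positive_coef_sym d f k : gamma_positive d f -> (k <= d)%N ->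
  f`_(d - k) = f`_k.
Proof. by move=> /gamma_positive_recip {2}<- kd; rewrite coef_poly ltnS kd. Qed.

Lemma gamma_positive_coef_ge d f k l : gamma_positive d f ->
  (k <= l)%N -> (d <= k + l)%N -> f`_l <= f`_k.
Proof.
move=> gf kl dkl; have [ld | dl] := leqP l d; last first.
  by rewrite (gamma_positive_coef_gt gf dl) (gamma_positive_coef_ge0 _ gf).
by rewrite -(gamma_positive_coef_sym gf ld) (gamma_positive_coef_le gf) //; lia.
Qed.

(** The symmetric part a contributes equally at [k] and [d - k]; what remains is to compare b at k -
    1 and d - k - 1, and b is unimodal about (d - 1)/2. *)
Lemma bi_gamma_positive_coef_le d f k : (size f <= d.+1)%N ->
  bi_gamma_positive d f -> (k <= d - k)%N -> f`_k <= f`_(d - k).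
Proof.
move=> sf [ga gb] kd; rewrite (sym_decompE sf) !coefD !coefXM.
rewrite (gamma_positive_coef_sym ga) ?lerD2l; last lia.
case: k kd => [|k] kd /=.
  by case: eqP => // _; apply: (gamma_positive_coef_ge0 _ gb).
case: eqP => [|_]; first lia.
by apply: (gamma_positive_coef_le gb); lia.
Qed.

End GammaPositive.

(** Steps of even rank 2j in the chain compare [j] with [d - j]; steps of odd rank 2j + 1 compare
    [d - j] with [j + 1], two indices of sum d + 1. *)
Lemma alternatingly_increasingP (R : numDomainType) d (f : {poly R}) :
  (size f <= d.+1)%N ->
  (forall k, (k <= d - k)%N -> f`_k <= f`_(d - k)) ->
  (forall k, (0 < k <= d.+1 - k)%N -> f`_(d.+1 - k) <= f`_k) ->
  alternatingly_increasing d f.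
Proof.
move=> sf up down; split=> // k kd; rewrite /alt_index /=.
case: ifP => /= ok.
  rewrite uphalf_half ok; have := down k./2.+1; rewrite subSS => -> //; lia.
rewrite uphalf_half ok; apply: up; lia.
Qed.

Theorem theorem6 (R : realFieldType) (n : nat) (n_gt0 : (0 < n)%N)
  (mu : nat -> nat -> R)
  (mu_ge0 : forall i j, (i <= n)%N -> (j <= (n - i)./2)%N -> 0 <= mu i j)
  (p : {poly {poly R}})
  (def_p : p = \sum_(i < n.+1)
    (\sum_(j < (n - i)./2.+1)
       mu i j *: ('X^j * (1 + 'X) ^+ (n - i - j.*2))) *: 'X^i)
  (deg_p1 : size p.[1] = n)
  (p1_bigamma : bi_gamma_positive n.-1 p.[1])
  (y : R) (y_ge0 : 0 <= y) (y_le1 : y <= 1) :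
  alternatingly_increasing n.-1 p.[y%:P].
Proof.
case: n n_gt0 mu_ge0 def_p deg_p1 p1_bigamma => // d _ mu_ge0 def_p deg_p1 /=.
move=> p1_bigamma.
pose P (i : nat) : {poly R} := \sum_(j < (d.+1 - i)./2.+1)
  mu i j *: gamma_basis R (d.+1 - i) j.
have gP (i : 'I_d.+2) : gamma_positive (d.+1 - i) (P i).
  by exists (mu i); split=> // k; apply: mu_ge0; rewrite -ltnS.
have coefp z m : p.[z%:P]`_m = \sum_(i < d.+2) (P i)`_m * z ^+ i.
  rewrite def_p horner_sum coef_sum; apply: eq_bigr => i _.
  by rewrite hornerZ hornerXn -polyC_exp coefMC.
have coefp1 m : p.[1]`_m = \sum_(i < d.+2) (P i)`_m.
  by rewrite -[1]/(1%:P) coefp; apply: eq_bigr => i _; rewrite expr1n mulr1.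
apply: alternatingly_increasingP => [|k kd|k /andP[k0 kd]].
(* Only [P 0] can reach degree d + 1, and it enters without y; so beyond d the coefficients agree
   with those of p(x,1), which vanish. *)
- apply/leq_sizeP => m dm.
  transitivity p.[1]`_m; last by rewrite nth_default ?deg_p1.
  rewrite coefp coefp1; apply: eq_bigr => -[[|i] /= id] _.
    by rewrite mulr1.
  by rewrite (gamma_positive_coef_gt (gP (Ordinal id))) ?mul0r //=; lia.
- have up1 : p.[1]`_k <= p.[1]`_(d - k).
    by apply: bi_gamma_positive_coef_le; rewrite ?deg_p1.
  rewrite -subr_le0; rewrite -subr_le0 in up1; apply: le_trans _ up1.
  rewrite !coefp1 !coefp -!sumrB.
  (* For i = 0 the difference may be negative, but y^0 = 1 gives equality. For i >= 1 the nominal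
     degree is at most d = k + (d - k), so the difference is nonnegative. *)
  apply: ler_sum => -[[|i] /= id] _; first by rewrite !mulr1.
  rewrite -mulrBl ler_piMr ?exprn_ile1 // subr_ge0.
  by apply: (gamma_positive_coef_ge (gP (Ordinal id))) => //=; lia.
- rewrite !coefp ler_sum // => i _; rewrite ler_wpM2r ?exprn_ge0 //.
  by apply: (gamma_positive_coef_ge (gP i)) => //; lia.
Qed.
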